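(* Let $n\ge 2$. If $S\in\{\{g,o\},\{r,s\},\{b,y\}\}$ then \[F(J(T_n(S)),q)=\prod_{j=1}^n {n\brack j}_q=\prod_{1\le i\le j\le k\le n-1}\frac{[j+1]_q}{[j]_q}.\]
   Context: Let $T_n$ be the set of triples $(c_1,c_2,c_3)$ of nonnegative integers with $c_1+c_2+c_3\le n-2$. To the colors $r,g,y,b,o,s$ associate $v_r=(1,0,0)$, $v_g=(0,1,0)$, $v_y=(0,0,1)$, $v_b=(-1,1,0)$, $v_o=(-1,0,1)$, $v_s=(0,1,-1)$. For a set $S$ of colors, $T_n(S)$ is the poset on $T_n$ whose order is the reflexive–transitive closure of $p<p+v_x$ for $x\in S$ and $p,p+v_x\in T_n$. $J(P)$ is the set of order ideals (down-closed subsets, including $\emptyset$) of $P$, and $F(J(P),q)=\sum_{I\in J(P)}q^{|I|}$. Here $[m]_q=1+q+\dots+q^{m-1}$, $m!_q=[1]_q\cdots[m]_q$, and ${n\brack j}_q=\frac{n!_q}{j!_q\,(n-j)!_q}$. *)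

(* Defs.v *)
From HB Require Import structures.
From mathcomp Require Import all_boot all_order all_algebra.
From mathcomp Require Import zify.

Set Implicit Arguments.
Unset Strict Implicit.
Unset Printing Implicit Defensive.

Import Order.TTheory GRing.Theory Num.Theory.
Local Open Scope ring_scope.

Inductive color := Red | Green | Yellow | Blue | Orange | Silver.

Definition color_code (x : color) : nat :=
  match x with
  | Red => 0 | Green => 1 | Yellow => 2 | Blue => 3 | Orange => 4 | Silver => 5
  end.

Definition color_decode (k : nat) : option color :=
  nth None (map Some [:: Red; Green; Yellow; Blue; Orange; Silver]) k.

Lemma color_codeK : pcancel color_code color_decode.
Proof. by case. Qed.

HB.instance Definition _ := Countable.copy color (pcan_type color_codeK).

Lemma color_enumP :
  Finite.axiom [:: Red; Green; Yellow; Blue; Orange; Silver].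
Proof. by case. Qed.

HB.instance Definition _ := isFinite.Build color color_enumP.

Definition color_vec (x : color) : int * int * int :=
  match x with
  | Red    => (1, 0, 0)
  | Green  => (0, 1, 0)
  | Yellow => (0, 0, 1)
  | Blue   => (-1, 1, 0)
  | Orange => (-1, 0, 1)
  | Silver => (0, 1, -1)
  end.

(* Each coordinate of a triple of T_n is at most n - 2, so it lies in          *)
(* 'I_n.-1; for n < 2 the type is empty, as it should be.                      *)
Definition tetra (n : nat) :=
  {c : 'I_n.-1 * 'I_n.-1 * 'I_n.-1 | (c.1.1 + c.1.2 + c.2 <= n - 2)%N}.

Definition tetra_vec n (p : tetra n) : int * int * int :=
  ((val p).1.1%:Z, (val p).1.2%:Z, (val p).2%:Z).

(* T_n(S): an alias of T_n that carries the order generated by S.              *)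
Definition tetra_poset (n : nat) (S : {set color}) : Type := tetra n.

HB.instance Definition _ n S := Finite.on (tetra_poset n S).

Section TetraOrder.
Variables (n : nat) (S : {set color}).
Implicit Types p q : tetra_poset n S.

Definition tetra_step : rel (tetra_poset n S) :=
  fun p q => [exists x in S, tetra_vec q == tetra_vec p + color_vec x].

Definition tetra_le : rel (tetra_poset n S) := connect tetra_step.

(* The functional (a, b, c) |-> a + 3b + 2c increases along all six vectors.   *)
Definition tetra_height p : nat :=
  ((val p).1.1 + 3 * (val p).1.2 + 2 * (val p).2)%N.

Lemma tetra_step_height p q :
  tetra_step p q -> (tetra_height p < tetra_height q)%N.
Proof.
case/exists_inP=> x _ /eqP; rewrite /tetra_vec /tetra_height.
by case: x => /= -[]; lia.
Qed.

Lemma tetra_le_height p q :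
  tetra_le p q -> p = q \/ (tetra_height p < tetra_height q)%N.
Proof.
case/connectP=> s; elim: s p => [|p' s IHs] p /=; first by move=> _ ->; left.
case/andP=> /tetra_step_height lt_pp' ps /(IHs _ ps) [<-|lt_p'q]; right=> //.
exact: ltn_trans lt_p'q.
Qed.

Lemma tetra_le_refl : reflexive tetra_le.
Proof. exact: connect0. Qed.

Lemma tetra_le_anti : antisymmetric tetra_le.
Proof.
move=> p q /andP[/tetra_le_height[// |lt_pq] /tetra_le_height[// |lt_qp]].
by have := ltn_trans lt_pq lt_qp; rewrite ltnn.
Qed.

Lemma tetra_le_trans : transitive tetra_le.
Proof. exact: connect_trans. Qed.

End TetraOrder.

Fact tetra_display : Order.disp_t. Proof. exact: Order.Disp tt tt. Qed.

HB.instance Definition _ n S :=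
  Order.Le_isPOrder.Build tetra_display (tetra_poset n S)
    (@tetra_le_refl n S) (@tetra_le_anti n S) (@tetra_le_trans n S).

Lemma tetra_leE n S (p q : tetra_poset n S) :
  (p <= q)%O = connect (@tetra_step n S) p q.
Proof. by []. Qed.

Definition order_ideals d (P : finPOrderType d) : {set {set P}} :=
  [set I : {set P} | [forall x in I, forall y, (y <= x)%O ==> (y \in I)]].

Definition ideal_gf d (P : finPOrderType d) (K : fieldType) (q : K) : K :=
  \sum_(I in order_ideals P) q ^+ #|I|.

Definition qint (K : fieldType) (q : K) (m : nat) : K := \sum_(i < m) q ^+ i.

Definition qfact (K : fieldType) (q : K) (m : nat) : K :=
  \prod_(1 <= j < m.+1) qint q j.

Definition qbinom (K : fieldType) (q : K) (n j : nat) : K :=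
  qfact q n / (qfact q j * qfact q (n - j)).

(* The indeterminate q, in the field Frac(Z[q]) of rational functions.         *)
Definition qvar : {fraction {poly int}} := tofrac 'X.

(* Main.v *)
(** For each of the three sets [S] the poset [T_n(S)] is a disjoint union of
    products of two chains: one coordinate sum [m] (for instance [c_1 + c_3] when
    [S] is {g, o}) is constant along both steps, and the level [m] is a product
    of a chain with [m + 1] elements and a chain with [n - 1 - m] elements. The
    ideals of an [a] by [b] product of chains satisfy the recursion of q-Pascal:
    an ideal contains the top element of the bottom row, hence the whole row, or
    it avoids the last column. *)
Require Import Defs.
From HB Require Import structures.
From mathcomp Require Import all_boot all_order all_algebra.
From mathcomp Require Import zify ring.

Set Implicit Arguments.
Unset Strict Implicit.
Unset Printing Implicit Defensive.

Import Order.TTheory GRing.Theory Num.Theory.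
Local Open Scope ring_scope.

(** * Ideals of a subset of a poset, counted by size *)

Section IdealsInRegion.
Variables (d : Order.disp_t) (P : finPOrderType d) (K : fieldType) (q : K).
Implicit Types (D A : {set P}) (x y z : P).

(** Ideals for the order induced on [D], which need not be down-closed in [P]; recursions can thus
    shrink [D] without changing the ambient poset. *)
Definition ideals_in D : {set {set P}} :=
  [set A : {set P} | (A \subset D) &&
     [forall x in A, forall y in D, (y <= x)%O ==> (y \in A)]].

Definition ideals_in_gf D : K := \sum_(A in ideals_in D) q ^+ #|A|.

Lemma ideals_inP D A :
  reflect (A \subset D /\ forall x y, x \in A -> y \in D -> (y <= x)%O -> y \in A)
          (A \in ideals_in D).
Proof.
rewrite inE; apply: (iffP andP) => -[sAD cA]; split=> //.
  by move=> x y xA yD; move/forall_inP/(_ x xA)/forall_inP/(_ y yD)/implyP: cA; apply.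
by apply/forall_inP=> x xA; apply/forall_inP=> y yD; apply/implyP; apply: cA.
Qed.

Lemma ideals_in_gf0 : ideals_in_gf set0 = 1.
Proof.
rewrite /ideals_in_gf (big_pred1 set0) ?cards0 // => A.
apply/ideals_inP/eqP => [[/subset_leq_card]|->]; last by split=> // x y; rewrite inE.
by rewrite cards0 leqn0 cards_eq0 => /eqP.
Qed.

Lemma ideal_gfE : ideal_gf P q = ideals_in_gf setT.
Proof.
apply: eq_bigl => A; apply/idP/ideals_inP.
  rewrite inE => /forall_inP cA; split; first exact: subsetT.
  by move=> x y xA _ yx; have /forallP/(_ y)/implyP := cA x xA; apply.
case=> _ cA; rewrite inE; apply/forall_inP=> x xA; apply/forallP=> y.
by apply/implyP; apply: cA xA _; rewrite inE.
Qed.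

(** Ideals are sorted by whether they contain [x]. Those that do contain everything of [D] below
    [x], and the rest of them is an ideal of what remains; those that do not avoid everything above
    [x]. *)
Lemma ideals_in_gf_split D x : x \in D ->
  ideals_in_gf D =
    q ^+ #|[set y in D | (y <= x)%O]| * ideals_in_gf [set y in D | ~~ (y <= x)%O]
    + ideals_in_gf [set y in D | ~~ (x <= y)%O].
Proof.
move=> xD; rewrite /ideals_in_gf (bigID (fun A => x \in A)) /=; congr (_ + _); last first.
  apply: eq_bigl => A; apply/andP/ideals_inP => [[/ideals_inP[sAD cA] xA]|[sAD cA]].
    split=> [|y z yA]; last by (rewrite inE => /andP[zD _]; exact: cA yA zD).
    apply/subsetP=> y yA; rewrite inE (subsetP sAD) //=.
    by apply: contra xA => xy; exact: cA yA xD xy.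
  split; last first.
    by apply/negP=> /(subsetP sAD); rewrite inE lexx andbF.
  apply/ideals_inP; split=> [|y z yA zD zy].
    by apply/subsetP=> y /(subsetP sAD); rewrite inE => /andP[].
  apply: (cA y z yA _ zy); rewrite inE zD /=.
  have := subsetP sAD y yA; rewrite inE => /andP[_]; apply: contra => xz.
  exact: le_trans xz zy.
set L := [set y in D | (y <= x)%O].
(* Adjoining [L] and removing it are inverse bijections between the ideals of [D] minus [L] and the
   ideals of [D] containing [x]. *)
rewrite (reindex_onto (fun A => A :|: L) (fun A => A :\: L)) /=; last first.
  move=> A /andP[/ideals_inP[sAD cA] xA]; apply/setP=> y; rewrite !inE.
  case: (boolP ((y \in D) && (y <= x)%O)) => [/andP[yD yx]|_]; last by rewrite orbF.
  by rewrite orbT (cA x y).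
rewrite big_distrr /=; apply: eq_big => [A|A /andP[_ /eqP eqA]]; last first.
  rewrite -exprD addnC cardsU (_ : A :&: L = set0) ?cards0 ?subn0 //.
  by apply/setP=> y; rewrite -eqA !inE; case: (_ && (y <= x)%O); rewrite /= ?andbF.
apply/idP/ideals_inP => [/andP[/andP[/ideals_inP[sAD cA] _] /eqP eqA]|[sAD cA]].
  have subA y : y \in A -> y \notin L by rewrite -eqA inE => /andP[].
  split=> [|y z yA].
    apply/subsetP=> y yA; have := subA y yA.
    have yD : y \in D by apply: (subsetP sAD); rewrite inE yA.
    by rewrite !inE yD.
  rewrite inE => /andP[zD zNx] zy.
  have := cA y z _ zD zy; rewrite !inE yA zD (negPf zNx) orbF => /(_ isT) //.
have subA y : y \in A -> (y \in D) && ~~ (y <= x)%O.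
  by move/(subsetP sAD); rewrite inE.
apply/andP; split; last first.
  apply/eqP/setP=> y; rewrite !inE.
  case: (boolP (y \in A)) => [/subA/andP[-> /negPf->] //|_] /=.
  by rewrite andNb.
rewrite !inE xD lexx orbT andbT -[_ && _]/(_ && _).
apply/andP; split.
  apply/subsetP=> y; rewrite !inE => /orP[/subA/andP[] //|/andP[] //].
apply/forall_inP=> y yAL; apply/forall_inP=> z zD; apply/implyP=> zy.
rewrite !inE zD /=; case: (boolP (z <= x)%O) => [_|zNx]; first by rewrite orbT.
move: yAL; rewrite !inE orbF => /orP[yA|/andP[_ yx]].
  by apply: cA yA _ zy; rewrite inE zD.
by rewrite (le_trans zy yx) in zNx.
Qed.

End IdealsInRegion.

(** * Identities for q-binomials *)

Section QBinomials.
Variables (K : fieldType) (q : K).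
Hypothesis qint_neq0 : forall m, (0 < m)%N -> qint q m != 0.

Lemma qfactS m : qfact q m.+1 = qfact q m * qint q m.+1.
Proof. by rewrite /qfact big_nat_recr. Qed.

Lemma qfact_neq0 m : qfact q m != 0.
Proof.
elim: m => [|m IHm]; first by rewrite /qfact big_geq ?oner_eq0.
by rewrite qfactS mulf_neq0 ?qint_neq0.
Qed.

Lemma qintD a b : qint q (a + b) = qint q a + q ^+ a * qint q b.
Proof.
rewrite /qint big_split_ord /=; congr (_ + _).
by rewrite big_distrr /=; apply: eq_bigr => i _; rewrite exprD.
Qed.

Lemma qbinom0 n : qbinom q n 0 = 1.
Proof. by rewrite /qbinom subn0 {2}/qfact big_geq // mul1r divff ?qfact_neq0. Qed.

Lemma qbinomnn n : qbinom q n n = 1.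
Proof. by rewrite /qbinom subnn {3}/qfact big_geq // mulr1 divff ?qfact_neq0. Qed.

(** After clearing denominators this is the splitting of [qint q (a.+1 + b.+1)] given by [qintD]. *)
Lemma qbinom_pascal a b :
  qbinom q (a.+1 + b.+1) a.+1
    = q ^+ a.+1 * qbinom q (a.+1 + b) a.+1 + qbinom q (a + b.+1) a.
Proof.
rewrite /qbinom ![(_ + _ - _)%N]addKn.
have := qintD a.+1 b.+1; rewrite addSnnS !addnS addSn !qfactS -/addn => ->.
by field; rewrite !qfact_neq0 !qint_neq0.
Qed.

Lemma qbinomS n j : (j <= n)%N ->
  qbinom q n.+1 j = qbinom q n j * (qint q n.+1 / qint q (n.+1 - j)).
Proof.
by move=> le_jn; rewrite /qbinom subSn // !qfactS; field; rewrite !qfact_neq0 qint_neq0.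
Qed.

Lemma prod_qint_ratio i n : (0 < i)%N -> (i <= n)%N ->
  \prod_(i <= j < n) (qint q j.+1 / qint q j) = qint q n / qint q i.
Proof.
move=> i_gt0 /subnKC <-; elim: (n - i)%N => [|k IHk].
  by rewrite addn0 big_geq // divff ?qint_neq0.
rewrite addnS big_nat_recr ?leq_addr //= IHk.
by field; rewrite !qint_neq0 // addn_gt0 i_gt0.
Qed.

(** Induction on [n]: passing from [n] to [n + 1] multiplies the left side by the ratios of
    [qint q n.+1] to [qint q i], for [i] from 1 to [n]. On the right the new factors are those with
    [k = n], and their product over [j] telescopes to the same ratio for each [i]. *)
Lemma prod_qbinom n :
  \prod_(1 <= j < n.+1) qbinom q n j
    = \prod_(1 <= i < n) \prod_(i <= j < n) \prod_(j <= k < n) (qint q j.+1 / qint q j).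
Proof.
case: n => [|n]; first by rewrite !big_geq.
elim: n => [|n IHn]; first by rewrite big_nat1 qbinomnn [RHS]big_geq.
have -> : \prod_(1 <= j < n.+3) qbinom q n.+2 j =
    (\prod_(1 <= j < n.+2) qbinom q n.+1 j)
    * \prod_(1 <= j < n.+2) (qint q n.+2 / qint q j).
  rewrite big_nat_recr //= qbinomnn mulr1.
  (* Reversal turns [j] into [n.+2 - j], the denominator that [qbinomS] produces. *)
  rewrite [X in _ = _ * X]big_nat_rev /= add1n -big_split /=.
  by apply: eq_big_nat => j /andP[_ lt_j]; rewrite qbinomS // subSS.
rewrite IHn.
transitivity (\prod_(1 <= i < n.+2) ((\prod_(i <= j < n.+1) \prod_(j <= k < n.+1)
   (qint q j.+1 / qint q j)) * (qint q n.+2 / qint q i))); last first.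
  apply: eq_big_nat => i /andP[i_gt0 lt_i].
  rewrite -prod_qint_ratio //; last exact: ltnW.
  (* The range of [j] may be extended to [n.+1], as the product over [k] is then empty. *)
  transitivity ((\prod_(i <= j < n.+2) \prod_(j <= k < n.+1) (qint q j.+1 / qint q j))
     * \prod_(i <= j < n.+2) (qint q j.+1 / qint q j)).
    by rewrite [X in _ = X * _]big_nat_recr //= [X in _ = _ * X * _]big_geq // mulr1.
  rewrite -big_split /=; apply: eq_big_nat => j /andP[_ lt_j].
  by rewrite [RHS]big_nat_recr.
by rewrite [RHS]big_split /= [X in _ = X * _]big_nat_recr //= [X in _ = _ * X * _]big_geq // mulr1.
Qed.

End QBinomials.

(** The underlying polynomial takes the value [m] at 1. *)
Lemma qint_qvar_neq0 m : (0 < m)%N -> qint qvar m != 0.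
Proof.
move=> m_gt0; rewrite /qint /qvar.
have -> : \sum_(i < m) (tofrac ('X : {poly int})) ^+ i
    = tofrac (\sum_(i < m) 'X^i : {poly int}).
  by rewrite rmorph_sum /=; apply: eq_bigr => i _; rewrite rmorphXn.
rewrite tofrac_eq0; apply/eqP => /(congr1 (fun p => p.[1])).
rewrite horner_sum horner0 (eq_bigr (fun=> 1)) => [|i _]; last by rewrite hornerXn expr1n.
by rewrite sumr_const card_ord => /eqP; rewrite pnatr_eq0 -leqn0 leqNgt m_gt0.
Qed.

(** * Posets whose levels are products of two chains *)

Section ChainProducts.
Variables (d : Order.disp_t) (P : finPOrderType d) (K : fieldType) (q : K).
Hypothesis qint_neq0 : forall m, (0 < m)%N -> qint q m != 0.
Variables (n : nat) (level col row : P -> nat).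
Hypothesis coord_inj : forall x y,
  level x = level y -> col x = col y -> row x = row y -> x = y.
Hypothesis coord_bound : forall x,
  (col x <= level x)%N /\ (level x + row x < n)%N.
Hypothesis coord_surj : forall m i j, (i <= m)%N -> (m + j < n)%N ->
  exists x, [/\ level x = m, col x = i & row x = j].
Hypothesis le_coord : forall x y, (x <= y)%O =
  [&& level x == level y, (col x <= col y)%N & (row x <= row y)%N].

(* Carrying along the levels below [m] makes a product formula for the ideals of
   a disjoint union unnecessary. *)
Let region m a k : {set P} := [set x | (level x < m)%N ||
  [&& level x == m, (col x < a)%N & (k <= row x)%N]].

(** The equation on [b] says that [b] rows remain from row [k] on, so the region meets level [m] in
    an [a] by [b] rectangle. The double induction follows q-Pascal; an empty rectangle is the base
    case. *)
Lemma region_gf m a b k : (a <= m.+1)%N -> (m + k + b)%N = n ->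
  ideals_in_gf q (region m a k) = qbinom q (a + b) a * ideals_in_gf q (region m 0 0).
Proof.
elim: a b k => [|a IHa] b k le_am.
  move=> _; rewrite qbinom0 // mul1r.
  by apply/(congr1 (ideals_in_gf q))/setP=> x; rewrite !inE !ltn0 !andbF.
elim: b k => [|b IHb] k def_n.
  rewrite addn0 qbinomnn // mul1r.
  apply/(congr1 (ideals_in_gf q))/setP=> x; rewrite !inE; have := coord_bound x; lia.
(* The splitting element is the cell in the last column of the bottom row. *)
have [x [xm xa xk]] : exists x, [/\ level x = m, col x = a & row x = k].
  by apply: coord_surj; lia.
have xD : x \in region m a.+1 k by rewrite inE xm xa xk eqxx !leqnn orbT.
rewrite (ideals_in_gf_split q xD) qbinom_pascal // mulrDl -mulrA.
rewrite -(IHb k.+1); last by lia.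
rewrite -(IHa b.+1 k); [|lia|lia].
congr (_ * _ + _).
- congr (_ ^+ _); rewrite -[RHS]card_ord.
  (* The cells below [x] form the bottom row; they are enumerated by column to show that there are
     [a.+1] of them. *)
  have cell i : (i < a.+1)%N -> exists y, [/\ level y = m, col y = i & row y = k].
    by move=> lt_i; apply: coord_surj; lia.
  have F (i : 'I_a.+1) : {y | [&& level y == m, col y == i & row y == k]}.
    apply: sigW; have [y [yl yc yr]] := cell i (ltn_ord i).
    by exists y; rewrite yl yc yr !eqxx.
  have injF : injective (fun i => sval (F i)).
    move=> i j /(congr1 col); move: (svalP (F i)) (svalP (F j)).
    by move=> /and3P[_ /eqP-> _] /and3P[_ /eqP-> _] /ord_inj.
  rewrite -(card_codom injF); apply: eq_card => y; rewrite !inE le_coord xm xa xk.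
  apply/idP/codomP => [H|[i ->]]; last first.
    by have := svalP (F i); have := ltn_ord i; lia.
  have lt_y : (col y < a.+1)%N by lia.
  exists (Ordinal lt_y); have /= := svalP (F (Ordinal lt_y)).
  by move=> /and3P[/eqP ? /eqP ? /eqP ?]; apply: coord_inj; lia.
- by apply/(congr1 (ideals_in_gf q))/setP=> y; rewrite !inE le_coord xm xa xk; lia.
- by apply/(congr1 (ideals_in_gf q))/setP=> y; rewrite !inE le_coord xm xa xk; lia.
Qed.

(** Level [m] has [m + 1] columns and [n - m] rows, hence contributes [qbinom q n.+1 m.+1]; levels
    are added one at a time. The factor [j = n.+1] equals 1. *)
Lemma chain_products_gf : ideal_gf P q = \prod_(1 <= j < n.+2) qbinom q n.+1 j.
Proof.
suff gf m : (m <= n)%N ->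
    ideals_in_gf q (region m 0 0) = \prod_(1 <= j < m.+1) qbinom q n.+1 j.
  rewrite big_nat_recr //= qbinomnn // mulr1 -gf // ideal_gfE.
  by apply/(congr1 (ideals_in_gf q))/setP=> x; rewrite !inE; have := coord_bound x; lia.
elim: m => [|m IHm] lt_mn.
  rewrite big_geq // -[RHS](ideals_in_gf0 P q).
  by apply/(congr1 (ideals_in_gf q))/setP=> x; rewrite !inE ltn0 andbF.
rewrite big_nat_recr //= -IHm 1?ltnW // mulrC.
(* All levels up to [m] amount to the levels below [m] together with all [m.+1] columns of level
   [m]. *)
have -> : region m.+1 0 0 = region m m.+1 0.
  by apply/setP=> x; rewrite !inE; have := coord_bound x; lia.
rewrite (@region_gf m m.+1 (n - m) 0) //; last by lia.
by congr (qbinom q _ _ * _); lia.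
Qed.

End ChainProducts.

(** * From unit steps in two coordinates to the product order *)

Section TetraChains.
Variables (n : nat) (S : {set color}).
Variables (level col row : tetra_poset n S -> nat).
Hypothesis coord_surj : forall m i j, (i <= m)%N -> (m + j < n.-1)%N ->
  exists x, [/\ level x = m, col x = i & row x = j].
Hypothesis coord_inj : forall x y,
  level x = level y -> col x = col y -> row x = row y -> x = y.
Hypothesis coord_bound : forall x,
  (col x <= level x)%N /\ (level x + row x < n.-1)%N.
Hypothesis step_coord : forall x y, tetra_step x y =
  (level x == level y) &&
  ((col y == (col x).+1) && (row y == row x) || (col y == col x) && (row y == (row x).+1)).

(** Steps keep the level and raise one coordinate. Conversely, [y] is reached from [x] by raising
    the column first and then the row; the bounds at [y] keep the intermediate cells in the
    poset. *)
Lemma tetra_le_coord x y : (x <= y)%O =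
  [&& level x == level y, (col x <= col y)%N & (row x <= row y)%N].
Proof.
rewrite tetra_leE; apply/idP/idP.
  case/connectP=> s; elim: s x => [|z s IHs] x /=; first by move=> _ ->; rewrite eqxx !leqnn.
  by case/andP; rewrite step_coord => ? /IHs{}IHs /IHs; lia.
have [k] := ubnP (col y - col x + (row y - row x)).
elim: k x => // k IHk x lt_k /and3P[/eqP lxy cxy rxy].
have by' := coord_bound y.
have next i j : (i <= level x)%N -> (level x + j < n.-1)%N ->
    (col x <= i <= col y)%N -> (row x <= j <= row y)%N ->
    (i == (col x).+1) && (j == row x) || (i == col x) && (j == (row x).+1) ->
    connect (@tetra_step n S) x y.
  move=> lei ltj hi hj hij; have [z [zl zc zr]] := coord_surj lei ltj.
  apply: (connect_trans (y := z)).
    by apply: connect1; rewrite step_coord zl zc zr eqxx.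
  by apply: IHk; rewrite ?zl ?zc ?zr; lia.
case: (ltnP (col x) (col y)) => [lt_c|le_c].
  by apply: (next (col x).+1 (row x)); lia.
case: (ltnP (row x) (row y)) => [lt_r|le_r].
  by apply: (next (col x) (row x).+1); lia.
by have -> : x = y by apply: coord_inj; lia.
Qed.

Lemma tetra_chains_gf : (0 < n)%N ->
  ideal_gf (tetra_poset n S) qvar = \prod_(1 <= j < n.+1) qbinom qvar n j.
Proof.
move=> n_gt0.
have := chain_products_gf qint_qvar_neq0 coord_inj coord_bound coord_surj tetra_le_coord.
(* The coordinate bound is [n.-1], so the upper index [n.-1.+1] becomes [n]. *)
by rewrite prednK.
Qed.

End TetraChains.

(** * Chain coordinates for the three color sets *)

Section TetraCoordinates.
Variable n : nat.
Implicit Types p : tetra n.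

Let c1 p : nat := (val p).1.1.
Let c2 p : nat := (val p).1.2.
Let c3 p : nat := (val p).2.

Lemma tetra_surj i j k : (i + j + k < n.-1)%N ->
  exists p, [/\ c1 p = i, c2 p = j & c3 p = k].
Proof.
move=> lt_n.
have [li lj lk] : [/\ i < n.-1, j < n.-1 & k < n.-1]%N by split; lia.
pose c := (Ordinal li, Ordinal lj, Ordinal lk).
have cP : (c.1.1 + c.1.2 + c.2 <= n - 2)%N by rewrite /=; lia.
by exists (exist _ c cP).
Qed.

Lemma tetra_inj p p' : c1 p = c1 p' -> c2 p = c2 p' -> c3 p = c3 p' -> p = p'.
Proof.
case: p p' => [[[i j] k] cP] [[[i' j'] k'] cP']; rewrite /c1 /c2 /c3 /=.
by move=> /ord_inj ei /ord_inj ej /ord_inj ek; apply: val_inj; rewrite /= ei ej ek.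
Qed.

Lemma tetra_bound p : (c1 p + c2 p + c3 p < n.-1)%N.
(* For [n < 2] the truncated [n - 2] is 0, and the strict bound comes from ['I_n.-1] being empty. *)
Proof. by have := valP p; have := ltn_ord (val p).2; rewrite /c1 /c2 /c3; lia. Qed.

Lemma tetra_step2 (x y : color) (p p' : tetra_poset n [set x; y]) :
  tetra_step p p' = (tetra_vec p' == tetra_vec p + color_vec x)
                 || (tetra_vec p' == tetra_vec p + color_vec y).
Proof.
apply/exists_inP/orP => [[z]|].
  by rewrite !inE => /orP[]/eqP->; [left | right].
by case=> ?; [exists x | exists y]; rewrite // !inE eqxx ?orbT.
Qed.

Lemma tetra_vec_eq p p' (v : int * int * int) :
  (tetra_vec p' == tetra_vec p + v) =
  [&& (c1 p')%:Z == (c1 p)%:Z + v.1.1, (c2 p')%:Z == (c2 p)%:Z + v.1.2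
    & (c3 p')%:Z == (c3 p)%:Z + v.2].
Proof. by rewrite /tetra_vec !xpair_eqE -andbA. Qed.

(** Green raises [c2]; orange moves a unit from [c1] to [c3], fixing their sum. *)
Lemma green_orange_gf : (0 < n)%N ->
  ideal_gf (tetra_poset n [set Green; Orange]) qvar
    = \prod_(1 <= j < n.+1) qbinom qvar n j.
Proof.
apply: (@tetra_chains_gf n _ (fun p => c1 p + c3 p)%N c3 c2).
- move=> m i j le_i lt_m; have [|p [p1 p2 p3]] := @tetra_surj (m - i) j i; first by lia.
  by exists p; split=> //; lia.
- by move=> p p' ? ? ?; apply: tetra_inj; lia.
- by move=> p; have := tetra_bound p; lia.
- by move=> p p'; rewrite tetra_step2 !tetra_vec_eq /=; lia.
Qed.

(** Red raises [c1]; silver moves a unit from [c3] to [c2]. *)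
Lemma red_silver_gf : (0 < n)%N ->
  ideal_gf (tetra_poset n [set Red; Silver]) qvar
    = \prod_(1 <= j < n.+1) qbinom qvar n j.
Proof.
apply: (@tetra_chains_gf n _ (fun p => c2 p + c3 p)%N c2 c1).
- move=> m i j le_i lt_m; have [|p [p1 p2 p3]] := @tetra_surj j i (m - i); first by lia.
  by exists p; split=> //; lia.
- by move=> p p' ? ? ?; apply: tetra_inj; lia.
- by move=> p; have := tetra_bound p; lia.
- by move=> p p'; rewrite tetra_step2 !tetra_vec_eq /=; lia.
Qed.

(** Yellow raises [c3]; blue moves a unit from [c1] to [c2]. *)
Lemma blue_yellow_gf : (0 < n)%N ->
  ideal_gf (tetra_poset n [set Blue; Yellow]) qvar
    = \prod_(1 <= j < n.+1) qbinom qvar n j.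
Proof.
apply: (@tetra_chains_gf n _ (fun p => c1 p + c2 p)%N c2 c3).
- move=> m i j le_i lt_m; have [|p [p1 p2 p3]] := @tetra_surj (m - i) i j; first by lia.
  by exists p; split=> //; lia.
- by move=> p p' ? ? ?; apply: tetra_inj; lia.
- by move=> p; have := tetra_bound p; lia.
- by move=> p p'; rewrite tetra_step2 !tetra_vec_eq /=; lia.
Qed.

End TetraCoordinates.

Theorem theorem8 (n : nat) (S : {set color}) (hn : (2 <= n)%N)
    (hS : [\/ S = [set Green; Orange], S = [set Red; Silver]
            | S = [set Blue; Yellow]]) :
  ideal_gf (tetra_poset n S) qvar = \prod_(1 <= j < n.+1) qbinom qvar n j
  /\ \prod_(1 <= j < n.+1) qbinom qvar n j
     = \prod_(1 <= i < n) \prod_(i <= j < n) \prod_(j <= k < n)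
         (qint qvar j.+1 / qint qvar j).
Proof.
have n_gt0 : (0 < n)%N by exact: ltnW.
split; last exact: (prod_qbinom qint_qvar_neq0).
by case: hS => ->; [exact: green_orange_gf | exact: red_silver_gf | exact: blue_yellow_gf].
Qed.
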